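(* Let $\bar\rho=\langle\rho_n : n\in\omega\rangle$ be an admissible sequence of functions and let $h\in\omega^\omega$ converge to infinity (i.e. $\lim_{k\to\infty}h(k)=\infty$). Then there is a set $\mathcal H_{\bar\rho,h}=\{h_n : n\in\omega\}\subseteq\omega^\omega$ with $h_0=h$ such that every $\sigma$-$\bar\rho$-linked forcing notion is $\mathrm{Lc}^*(\mathcal H_{\bar\rho,h})$-good.
   Context: Convention: in a forcing notion $\mathbb P$, $q\le p$ means that $q$ is stronger than $p$. A common extension of a set $Q\subseteq\mathbb P$ is an element $r\in\mathbb P$ (stronger than or equal to $q$) for every $q\in Q$. Admissible sequence: a sequence $\bar\rho=\langle\rho_n : n\in\omega\rangle$ of functions $\rho_n\colon\omega\to\omega$ such that for every $n$: $\lim_{k\to\infty}\rho_n(k)=\infty$, $\rho_n(k)\le k$ for all $k$, $\rho_n(k)\ge 2$ for all $k\ge 2$, and $\rho_n(k)\ge\rho_{n+1}(k)$ for all $k$. $\sigma$-$\bar\rho$-linked: $\mathbb P$ is $\sigma$-$\bar\rho$-linked if there is a sequence $\langle P_n : n\in\omega\rangle$ of subsets of $\mathbb P$ such that (a) $\bigcup_{n\in\omega}P_n$ is dense in $\mathbb P$, and (b) for all $n,k<\omega$, whenever $\{p_i : i<k\}\subseteq P_n$ consists of $k$ pairwise distinct conditions, there is a subset $Q\subseteq\{p_i : i<k\}$ of size $\rho_n(k)$ that has a common extension in $\mathbb P$. For a set $\mathcal H\subseteq\omega^\omega$, let $\mathcal S(\omega,\mathcal H)$ be the set of all $\varphi\colon\omega\to[\omega]^{<\aleph_0}$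 for which there is $h\in\mathcal H$ with $|\varphi(i)|\le h(i)$ for all $i<\omega$. For $x\in\omega^\omega$ and $\varphi\colon\omega\to[\omega]^{<\aleph_0}$, write $x\in^*\varphi$ iff $x(n)\in\varphi(n)$ for all but finitely many $n$. Let $\mathrm{Lc}^*(\mathcal H)$ be the relational system $\langle\omega^\omega,\mathcal S(\omega,\mathcal H),\in^*\rangle$. Goodness: for a relational system $\mathbf R=\langle X,Y,\sqsubset\rangle$ (here with $X,Y,\sqsubset$ given by definitions reinterpreted in forcing extensions, with $\mathcal H$ fixed in the ground model), a forcing notion $\mathbb P$ is $\mathbf R$-good if for every $\mathbb P$-name $\dot y$ for a member of $Y$ there is a nonempty countable set $H\subseteq Y$ in the ground model such that, for every $x\in X$ (in the ground model), if $x\not\sqsubset y$ for all $y\in H$, then $\Vdash_{\mathbb P} x\not\sqsubset\dot y$. *)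

(* Defs.v *)
From mathcomp Require Import all_boot all_order.
From mathcomp Require Import finmap.
From mathcomp Require Import all_classical.

Set Implicit Arguments.
Unset Strict Implicit.
Unset Printing Implicit Defensive.

Local Open Scope classical_set_scope.

Record admissible (rho : nat -> nat -> nat) : Prop := Admissible {
  admissible_cvg : forall n, rho n @ \oo --> \oo ;
  admissible_le : forall n k, rho n k <= k ;
  admissible_ge2 : forall n k, 2 <= k -> 2 <= rho n k ;
  admissible_noninc : forall n k, rho n.+1 k <= rho n k }.

(* A forcing notion is a preorder, and [(q <= p)%O] reads "q is stronger than
   p".  A set of k pairwise distinct conditions is a finite set of
   cardinality k. *)
Section Forcing.
Context {d : Order.disp_t} (P : preorderType d).

Definition common_extension (Q : {fset P}) (r : P) : Prop :=
  forall q, q \in Q -> (r <= q)%O.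

Definition dense (D : set P) : Prop :=
  forall p, exists2 q, D q & (q <= p)%O.

Definition sigma_linked (rho : nat -> nat -> nat) : Prop :=
  exists P_ : nat -> set P,
    dense (\bigcup_n P_ n) /\
    forall (n : nat) (A : {fset P}), [set` A] `<=` P_ n ->
      exists Q : {fset P},
        [/\ (Q `<=` A)%fset, #|` Q| = rho n #|` A| &
            exists r, common_extension Q r].

End Forcing.

(* Sets of the ground model, as well-founded trees.  Distinct trees may denote
   the same set. *)
Inductive vset : Type := VSet (T : Type) of T -> vset.

Fixpoint vnat (n : nat) : vset :=
  if n is m.+1 then
    let: VSet T f := vnat m in VSet (fun o : option T => oapp f (vnat m) o)
  else VSet (fun v : void => match v with end).

Definition vomega : vset := VSet vnat.

Definition vpair (a b : vset) : vset :=
  VSet (fun c : bool => if c then a else b).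

(* The Kuratowski pair. *)
Definition vopair (a b : vset) : vset := vpair (vpair a a) (vpair a b).

Definition vreal (x : nat -> nat) : vset :=
  VSet (fun n => vopair (vnat n) (vnat (x n))).

Definition vreals (H : set (nat -> nat)) : vset :=
  VSet (fun x : {x | H x} => vreal (sval x)).

(* P-names: [Name s c] is the name {(s i, c i) : i in T}. *)
Inductive name (P : Type) : Type :=
  Name (T : Type) of (T -> name P) & (T -> P).

(* The canonical name of a ground model set.  No largest condition is assumed,
   so every element is paired with every condition. *)
Fixpoint check (P : Type) (a : vset) : name P :=
  let: VSet T f := a in
  Name (fun u : T * P => check P (f u.1)) (fun u : T * P => u.2).

(* First-order formulas of set theory with constants in N (closed formulas,
   in higher-order abstract syntax). *)
Inductive formula (N : Type) : Type :=
| Mem of N & N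
| Eq of N & N
| Not of formula N
| And of formula N & formula N
| All of (N -> formula N).

Section ForcingRelation.
Context {d : Order.disp_t} {P : preorderType d}.

(* p forces a = b: whenever (s, c) is in a, p forces that s is an element of b
   if c is in the generic filter, and symmetrically. *)
Fixpoint forces_eq (a b : name P) (p : P) {struct a} : Prop :=
  let: Name T s c := a in
  let: Name U t e := b in
  (forall i q, (q <= p)%O -> (q <= c i)%O ->
     exists2 r, (r <= q)%O &
       exists2 j, (r <= e j)%O & forces_eq (s i) (t j) r) /\
  (forall j q, (q <= p)%O -> (q <= e j)%O ->
     exists2 r, (r <= q)%O &
       exists2 i, (r <= c i)%O & forces_eq (s i) (t j) r).

Definition forces_mem (a b : name P) (p : P) : Prop :=
  let: Name U t e := b in
  forall q, (q <= p)%O ->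
    exists2 r, (r <= q)%O &
      exists2 j, (r <= e j)%O & forces_eq a (t j) r.

Fixpoint forces (p : P) (phi : formula (name P)) : Prop :=
  match phi with
  | Mem a b => forces_mem a b p
  | Eq a b => forces_eq a b p
  | Not psi => forall q, (q <= p)%O -> ~ forces q psi
  | And psi chi => forces p psi /\ forces p chi
  | All F => forall a, forces p (F a)
  end.

Definition forced (phi : formula (name P)) : Prop := forall p, forces p phi.

End ForcingRelation.

Section Formulas.
Context {N : Type}.
Implicit Types (a b f s z A B : N) (phi psi : formula N) (F : N -> formula N).

Definition Or phi psi := Not (And (Not phi) (Not psi)).
Definition Imp phi psi := Not (And phi (Not psi)).
Definition Iff phi psi := And (Imp phi psi) (Imp psi phi).
Definition Ex F := Not (All (fun x => Not (F x))).
Definition AllIn A F := All (fun x => Imp (Mem x A) (F x)).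
Definition ExIn A F := Ex (fun x => And (Mem x A) (F x)).

Definition Subset A B := AllIn A (fun x => Mem x B).

Definition IsPair z a b := All (fun w => Iff (Mem w z) (Or (Eq w a) (Eq w b))).

(* Matches [vopair]. *)
Definition IsOpair z a b :=
  Ex (fun u => Ex (fun v =>
    And (IsPair u a a) (And (IsPair v a b) (IsPair z u v)))).

(* (a, b) is an element of f *)
Definition Maps f a b := ExIn f (fun z => IsOpair z a b).

(* The codomain is the class {b | F b}. *)
Definition IsFun f A F :=
  And (AllIn f (fun z => ExIn A (fun a => Ex (fun b => And (F b) (IsOpair z a b)))))
 (And (AllIn A (fun a => Ex (fun b => Maps f a b)))
      (All (fun a => All (fun b => All (fun b' =>
         Imp (And (Maps f a b) (Maps f a b')) (Eq b b')))))).

Definition CardLe A B :=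
  Ex (fun g =>
    And (IsFun g A (fun b => Mem b B))
        (All (fun a => All (fun a' => All (fun b =>
           Imp (And (Maps g a b) (Maps g a' b)) (Eq a a')))))).

Definition IsFinset omega s :=
  And (Subset s omega) (ExIn omega (fun n => CardLe s n)).

End Formulas.

(* A relational system <X, Y, R> given by definitions: its reading in the
   ground model, and the formulas defining it in forcing extensions.  In the
   latter, the map [vset -> N] supplies constants for ground model sets. *)
Record rel_system : Type := RelSystem {
  rel_dom_sort : Type ;
  rel_cod_sort : Type ;
  rel_dom : set rel_dom_sort ;
  rel_cod : set rel_cod_sort ;
  rel_rel : rel_dom_sort -> rel_cod_sort -> Prop ;
  (* ground model elements of X, as sets *)
  rel_dom_vset : rel_dom_sort -> vset ;
  rel_cod_formula : forall N : Type, (vset -> N) -> N -> formula N ;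
  rel_rel_formula : forall N : Type, (vset -> N) -> N -> N -> formula N }.

Definition good (R : rel_system) {d : Order.disp_t} (P : preorderType d) : Prop :=
  forall y' : name P, forced (rel_cod_formula R (check P) y') ->
    exists H : set (rel_cod_sort R),
      [/\ H `<=` rel_cod (r := R), H !=set0, countable H &
        forall x, rel_dom (r := R) x -> (forall y, H y -> ~ rel_rel x y) ->
          forced (Not (rel_rel_formula R (check P)
                         (check P (rel_dom_vset x)) y'))].

Definition slaloms (H : set (nat -> nat)) : set (nat -> {fset nat}) :=
  [set phi | exists2 h, H h & forall i, #|` phi i| <= h i].

Definition eventually_in (x : nat -> nat) (phi : nat -> {fset nat}) : Prop :=
  \forall n \near \oo, x n \in phi n.

Definition slaloms_formula (H : set (nat -> nat)) (N : Type) (c : vset -> N)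
    (phi : N) : formula N :=
  And (IsFun phi (c vomega) (IsFinset (c vomega)))
      (ExIn (c (vreals H)) (fun h => AllIn (c vomega) (fun i =>
         Ex (fun s => Ex (fun m =>
           And (Maps phi i s) (And (Maps h i m) (CardLe s m))))))).

(* For natural numbers, [Mem n m] says n < m. *)
Definition eventually_in_formula (N : Type) (c : vset -> N) (x phi : N) :
    formula N :=
  ExIn (c vomega) (fun m => AllIn (c vomega) (fun n =>
    Or (Mem n m)
       (Ex (fun k => Ex (fun s =>
          And (Maps x n k) (And (Maps phi n s) (Mem k s))))))).

Definition LcStar (H : set (nat -> nat)) : rel_system :=
  {| rel_dom_sort := nat -> nat ;
     rel_cod_sort := nat -> {fset nat} ;
     rel_dom := setT ;
     rel_cod := slaloms H ;
     rel_rel := eventually_in ;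
     rel_dom_vset := vreal ;
     rel_cod_formula := slaloms_formula H ;
     rel_rel_formula := eventually_in_formula |}.

(* Main.v *)
Require Import Defs.
From mathcomp Require Import all_boot all_order.
From mathcomp Require Import finmap.
From mathcomp Require Import all_classical.

Set Implicit Arguments.
Unset Strict Implicit.
Unset Printing Implicit Defensive.

Import Order.PreorderTheory.

Local Open Scope classical_set_scope.

(* [ssrbool] has a constructor of the same name. *)
Local Notation Mem := Defs.Mem.

(** Let P be linked by sets P_n, and let f be a name for a slalom bounded by an
    element of H = {h_m : m}.  A condition can be extended so that it decides
    the index m of the bound, and then so that it lies in some P_n.  So the sets
    D_{n,m} of the conditions of P_n that force f to be bounded by h_m have a
    dense union.  The ground model slaloms that witness goodness are
      phi_{n,m}(i) = {k : some p in D_{n,m} forces k to be in f(i)}.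
    If x escapes all of them, then no condition p forces x to be in f almost
    everywhere: some extension of p in some D_{n,m} would decide from which M on
    x(i) is in f(i), and then x(i) would be in phi_{n,m}(i) for all i >= M.

    It remains to see that phi_{n,m} is bounded by an element of H, and this
    determines H.  A condition of D_{n,m} forces at most c = h_m(i) numbers into
    f(i).  Let K be such that rho_n(K) > c.  If phi_{n,m}(i) had more than K c
    elements, then at least K distinct conditions of D_{n,m} would be involved;
    rho_n(K) > c of them have a common extension, which would force more than c
    numbers into f(i) ([linked_union_card]).  Hence H is the closure of {h}
    under the countably many operations that send a function g to
    i |-> K(n, g(i)) g(i), and it is countable.

    The forcing side of the argument is the computation that a condition cannot
    force n + 1 distinct numbers into a set that it forces to inject into n
    ([forces_CardLe]).  Since the sets f(i), the injections and their values are
    coded by Kuratowski pairs, this requires the injectivity of such pairs in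
    the forcing language ([forces_IsOpair_inj]) and the absoluteness of the
    canonical names of numbers and reals ([forces_Eq_nat_inj],
    [forces_Maps_vreal]). *)

(** * Logic of the forcing relation *)

Section Forces.
Context {d : Order.disp_t} {P : preorderType d}.
Implicit Types (p q r : P) (phi psi chi : formula (name P)).
Implicit Types (a b s z u v : name P).

Lemma forces_mono p q phi : (q <= p)%O -> forces p phi -> forces q phi.
Proof.
move=> qp; elim: phi => [a|[T s c]|psi _|psi IH1 chi IH2|F IH] /=.
- move=> [U t e] H r rq; exact: H (le_trans rq qp).
- move=> [U t e] [H1 H2]; split=> i r rq; [apply: H1|apply: H2];
    exact: le_trans rq qp.
- by move=> H r rq; apply: H (le_trans rq qp).
- by move=> [/IH1 ? /IH2].
- by move=> H a; apply/IH/H.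
Qed.

(** The truth of a formula is a regular open property: it may be checked densely
    often.  All case distinctions below rest on this, as only a dense set of
    extensions decides a disjunction or names a witness. *)
Lemma forces_dense p phi :
  (forall q, (q <= p)%O -> exists2 r, (r <= q)%O & forces r phi) ->
  forces p phi.
Proof.
elim: phi => [a|[T s c]|psi _|psi IH1 chi IH2|F IH] /=.
- move=> [U t e] H q /H[r rq] /(_ r (lexx r))[w wr Hw].
  by exists w => //; apply: le_trans wr rq.
- move=> [U t e] H; split=> i q qp qi; have [r rq [H1 H2]] := H q qp.
    have [w wr ?] := H1 i r (lexx r) (le_trans rq qi).
    by exists w => //; apply: le_trans wr rq.
  have [w wr ?] := H2 i r (lexx r) (le_trans rq qi).
  by exists w => //; apply: le_trans wr rq.
- move=> H q qp Hq; have [r rq /(_ r (lexx r))] := H q qp.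
  by apply; apply: forces_mono Hq.
- by move=> H; split; [apply: IH1|apply: IH2] => q /H[r ? []]; exists r.
- by move=> H a; apply: IH => q /H[r ? ?]; exists r.
Qed.

Lemma forces_NotNot p phi : forces p (Not (Not phi)) <-> forces p phi.
Proof.
split=> [H|H q qp /(_ q (lexx q))]; last by apply; apply: forces_mono H.
apply: forces_dense => q qp; apply: contrapT => nH.
by apply: (H q qp) => r rq Hr; apply: nH; exists r.
Qed.

Lemma forces_And p phi psi :
  forces p (And phi psi) <-> forces p phi /\ forces p psi.
Proof. by []. Qed.

(** Stated separately because applying a proof of [forces p (All F)] to a name
    leaves an unfolded [forces] that the other lemmas do not recognize;
    [forces_And] serves the same purpose for conjunctions. *)
Lemma forces_AllE p (F : name P -> formula (name P)) a :
  forces p (All F) -> forces p (F a).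
Proof. exact. Qed.

Lemma forces_Imp p phi psi :
  forces p (Imp phi psi) <->
  forall q, (q <= p)%O -> forces q phi -> forces q psi.
Proof.
split=> [H q qp Hq|H q qp [Hq /(_ q (lexx q))]]; last by apply; apply: H.
apply/forces_NotNot => r rq Hr; apply: (H r (le_trans rq qp)); split=> //.
exact: forces_mono Hq.
Qed.

Lemma forces_Iff p phi psi :
  forces p (Iff phi psi) <->
  forall q, (q <= p)%O -> (forces q phi <-> forces q psi).
Proof.
split=> [[/forces_Imp H1 /forces_Imp H2] q qp|H].
  by split; [apply: H1|apply: H2].
by split; apply/forces_Imp => q /H[].
Qed.

Lemma forces_Or p phi psi :
  forces p (Or phi psi) <->
  forall q, (q <= p)%O ->
    exists2 r, (r <= q)%O & forces r phi \/ forces r psi.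
Proof.
split=> H q qp; last first.
  move=> [H1 H2]; have [r rq [Hr|Hr]] := H q qp.
    exact: (H1 r rq).
  exact: (H2 r rq).
apply: contrapT => nH; apply: (H q qp); split=> r rq Hr; apply: nH.
  by exists r => //; left.
by exists r => //; right.
Qed.

Lemma forces_OrE p phi psi chi : forces p (Or phi psi) ->
  (forall q, (q <= p)%O -> forces q phi -> forces q chi) ->
  (forall q, (q <= p)%O -> forces q psi -> forces q chi) ->
  forces p chi.
Proof.
move=> /forces_Or H H1 H2; apply: forces_dense => q qp.
have [r rq Hr] := H q qp; exists r => //; have rp := le_trans rq qp.
by case: Hr; [apply: H1|apply: H2].
Qed.

Lemma forces_Or1 p phi psi : forces p phi -> forces p (Or phi psi).
Proof.
move=> H; apply/forces_Or => q qp; exists q => //; left.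
exact: forces_mono H.
Qed.

Lemma forces_Or2 p phi psi : forces p psi -> forces p (Or phi psi).
Proof.
move=> H; apply/forces_Or => q qp; exists q => //; right.
exact: forces_mono H.
Qed.

Lemma forces_Ex p (F : name P -> formula (name P)) :
  forces p (Ex F) <->
  forall q, (q <= p)%O -> exists2 r, (r <= q)%O & exists a, forces r (F a).
Proof.
split=> H q qp; last first.
  by move=> nH; have [r rq [a]] := H q qp; apply: (nH a r).
apply: contrapT => nH; apply: (H q qp) => a r rq Hr.
by apply: nH; exists r => //; exists a.
Qed.

Lemma forces_ExE p (F : name P -> formula (name P)) chi : forces p (Ex F) ->
  (forall q a, (q <= p)%O -> forces q (F a) -> forces q chi) -> forces p chi.
Proof.
move=> /forces_Ex H H1; apply: forces_dense => q qp.
have [r rq [a Hr]] := H q qp; exists r => //.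
exact: H1 (le_trans rq qp) Hr.
Qed.

Lemma forces_ExI p (F : name P -> formula (name P)) a :
  forces p (F a) -> forces p (Ex F).
Proof.
move=> H; apply/forces_Ex => q qp; exists q => //; exists a.
exact: forces_mono H.
Qed.

Lemma forces_Ex_witness p (F : name P -> formula (name P)) :
  forces p (Ex F) -> exists2 q, (q <= p)%O & exists a, forces q (F a).
Proof. by move=> /forces_Ex; apply. Qed.

Lemma forces_ExInE p b (F : name P -> formula (name P)) chi :
  forces p (ExIn b F) ->
  (forall q a, (q <= p)%O -> forces q (Mem a b) -> forces q (F a) ->
    forces q chi) ->
  forces p chi.
Proof.
move=> /forces_ExE H H1; apply: H => q a qp /forces_And[ab Fa].
exact: (H1 q a).
Qed.

Lemma forces_ExIn_witness p b (F : name P -> formula (name P)) :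
  forces p (ExIn b F) ->
  exists2 q, (q <= p)%O & exists2 a, forces q (Mem a b) & forces q (F a).
Proof.
move=> /forces_Ex_witness[q qp [a /forces_And[ab Fa]]].
by exists q => //; exists a.
Qed.

Lemma forces_AllIn p b (F : name P -> formula (name P)) a q :
  forces p (AllIn b F) -> (q <= p)%O -> forces q (Mem a b) -> forces q (F a).
Proof. by move=> /(forces_AllE a)/forces_Imp H qp; apply: H. Qed.

(** * Equality and membership *)

Lemma forces_Eq_refl p a : forces p (Eq a a).
Proof.
elim: a p => T s IH c p /=.
by split=> i q qp qi; exists q => //; exists i => //; apply: IH.
Qed.

Lemma forces_Eq_sym p a b : forces p (Eq a b) -> forces p (Eq b a).
Proof.
elim: a b p => T s IH c [U t e] p /= [H1 H2].
split=> i q qp qi; [have [r rq [j rj Hj]] := H2 i q qp qi|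
  have [r rq [j rj Hj]] := H1 i q qp qi];
by exists r => //; exists j => //; apply: IH.
Qed.

Lemma forces_Eq_trans p a b c :
  forces p (Eq a b) -> forces p (Eq b c) -> forces p (Eq a c).
Proof.
elim: a b c p => T s IH cs [U t e] [W w ew] p /= [H1 H2] [H3 H4].
split=> i q qp qi.
  have [r rq [j rj Hj]] := H1 i q qp qi.
  have [r' r'r [k r'k Hk]] := H3 j r (le_trans rq qp) rj.
  exists r'; first exact: le_trans r'r rq.
  exists k => //; apply: (IH i (t j)) => //.
  exact: (@forces_mono r r' (Eq (s i) (t j))).
have [r rq [j rj Hj]] := H4 i q qp qi.
have [r' r'r [k r'k Hk]] := H2 j r (le_trans rq qp) rj.
exists r'; first exact: le_trans r'r rq.
exists k => //; apply: (IH k (t j)) => //.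
exact: (@forces_mono r r' (Eq (t j) (w i))).
Qed.

Lemma forces_Mem_eql p a a' b :
  forces p (Eq a a') -> forces p (Mem a b) -> forces p (Mem a' b).
Proof.
case: b => U t e E /= H q qp; have [r rq [j rj Hj]] := H q qp.
exists r => //; exists j => //.
apply: (@forces_Eq_trans r a' a) => //; apply: forces_Eq_sym.
exact: forces_mono (le_trans rq qp) E.
Qed.

Lemma forces_Mem_eqr p a b b' :
  forces p (Eq b b') -> forces p (Mem a b) -> forces p (Mem a b').
Proof.
case: b b' => U t e [W w ew] /= [H1 _] H q qp.
have [r rq [j rj Hj]] := H q qp.
have [r' r'r [k r'k Hk]] := H1 j r (le_trans rq qp) rj.
exists r'; first exact: le_trans r'r rq.
exists k => //; apply: (@forces_Eq_trans r' a (t j)) => //.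
exact: (@forces_mono r r' (Eq a (t j))).
Qed.

(** * Kuratowski pairs *)

Lemma forces_IsPair p z a b :
  forces p (IsPair z a b) <->
  [/\ forces p (Mem a z), forces p (Mem b z) &
    forall w q, (q <= p)%O -> forces q (Mem w z) ->
      forces q (Or (Eq w a) (Eq w b))].
Proof.
split=> [H|[Ha Hb H] w].
  have {}H w : forall q, (q <= p)%O ->
    (forces q (Mem w z) <-> forces q (Or (Eq w a) (Eq w b))).
    exact/forces_Iff/(H w).
  split.
  - by apply/(H _ p) => //; apply/forces_Or1/forces_Eq_refl.
  - by apply/(H _ p) => //; apply/forces_Or2/forces_Eq_refl.
  - by move=> w q qp /H; apply.
apply: (forces_Iff p (Mem w z) (Or (Eq w a) (Eq w b))).2 => q qp.
split; first exact: H.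
move=> /forces_OrE; apply=> r rq /forces_Eq_sym E; apply: forces_Mem_eql E _.
  exact: forces_mono (le_trans rq qp) Ha.
exact: forces_mono (le_trans rq qp) Hb.
Qed.

Lemma forces_IsPair_eq p z a b b' : forces p (Eq b b') ->
  forces p (IsPair z a b) -> forces p (IsPair z a b').
Proof.
move=> E /forces_IsPair[Ha Hb H]; apply/forces_IsPair; split=> //.
  exact: forces_Mem_eql Hb.
move=> w q qp /(H _ _ qp)/forces_OrE; apply=> r rq Hr.
  exact: forces_Or1.
apply: forces_Or2; apply: (forces_Eq_trans Hr).
exact: forces_mono (le_trans rq qp) E.
Qed.

Lemma forces_IsOpairE p z a b chi : forces p (IsOpair z a b) ->
  (forall q u v, (q <= p)%O -> forces q (IsPair u a a) ->
    forces q (IsPair v a b) -> forces q (IsPair z u v) -> forces q chi) ->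
  forces p chi.
Proof.
move=> /forces_ExE H H1; apply: H => q u qp /forces_ExE.
apply=> r v rq [? [? ?]].
by apply: (H1 r u v) => //; apply: le_trans rq qp.
Qed.

Lemma forces_IsOpair_eq p z a b b' : forces p (Eq b b') ->
  forces p (IsOpair z a b) -> forces p (IsOpair z a b').
Proof.
move=> E /forces_IsOpairE; apply=> q u v qp Hu Hv Hz.
apply: (forces_ExI (a := u)); apply: (forces_ExI (a := v)); split=> //.
split=> //; apply: forces_IsPair_eq Hv; exact: forces_mono E.
Qed.

Lemma forces_IsPair_diag p z a w q :
  forces p (IsPair z a a) -> (q <= p)%O -> forces q (Mem w z) ->
  forces q (Eq w a).
Proof. by move=> /forces_IsPair[_ _ H] qp /(H _ _ qp)/forces_OrE; apply. Qed.

(** Kuratowski's argument: a is the only element of u, and u is one of u', v',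
    both of which contain a'; hence a = a'.  Then v and v' are compared with the
    elements of the other pair. *)
Lemma forces_IsOpair_inj p z z' a b a' b' : forces p (Eq z z') ->
  forces p (IsOpair z a b) -> forces p (IsOpair z' a' b') ->
  forces p (And (Eq a a') (Eq b b')).
Proof.
move=> E H H'.
move: H => /forces_IsOpairE; apply=> q u v qp Hu Hv Hz.
move: (forces_mono qp H') => /forces_IsOpairE.
apply=> {H'} r u' v' rq Hu' Hv' Hz'.
have {E} := forces_mono (le_trans rq qp) E.
move: (forces_mono rq Hu) (forces_mono rq Hv) (forces_mono rq Hz).
move=> {p q qp rq} {}Hu {}Hv {}Hz E.
move/forces_IsPair: (Hz) => [uz vz zE].
move/forces_IsPair: (Hz') => [uz' vz' zE'].
move/forces_IsPair: (Hu') => [au' _ _].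
move/forces_IsPair: (Hu) => [au _ _].
move/forces_IsPair: (Hv') => [av' bv' vE'].
move/forces_IsPair: (Hv) => [av bv vE].
have Es := forces_Eq_sym E.
have aa' : forces r (Eq a a').
  move: (zE' _ _ (lexx r) (forces_Mem_eqr E uz)) => /forces_OrE.
  apply=> q qr /forces_Eq_sym Eu.
    apply: forces_Eq_sym; apply: (forces_IsPair_diag Hu qr).
    apply: (forces_Mem_eqr Eu); exact: forces_mono au'.
  apply: forces_Eq_sym; apply: (forces_IsPair_diag Hu qr).
  apply: (forces_Mem_eqr Eu); exact: forces_mono av'.
split=> //.
(* b is one of a', b' and b' is one of a, b: either b = b' at once, or both are
   equal to the first coordinate. *)
have vv' q : (q <= r)%O -> forces q (Eq v v') -> forces q (Eq b b').
  move=> qr Evv'; have bq := forces_Mem_eqr Evv' (forces_mono qr bv).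
  move: (vE' _ _ qr bq) => /forces_OrE; apply=> // q' q'q Eb.
  have q'r := le_trans q'q qr.
  have b'q := forces_Mem_eqr (forces_Eq_sym (forces_mono q'q Evv'))
    (forces_mono q'r bv').
  move: (vE _ _ q'r b'q) => /forces_OrE; apply=> w wq' Eb';
    last exact: forces_Eq_sym.
  apply: forces_Eq_trans (forces_mono wq' Eb) _.
  apply: forces_Eq_trans (forces_Eq_sym Eb').
  by apply: forces_Eq_sym; apply: forces_mono aa'; apply: le_trans wq' q'r.
move: (zE' _ _ (lexx r) (forces_Mem_eqr E vz)) => /forces_OrE.
apply=> q qr Ev; last exact: vv'.
move: (zE _ _ qr (forces_mono qr (forces_Mem_eqr Es vz'))) => /forces_OrE.
apply=> w wq Ev'; last first.
  by apply: vv'; [apply: le_trans wq qr|apply: forces_Eq_sym].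
(* Here v = u' and v' = u are singletons, so b = a' and b' = a. *)
have wr := le_trans wq qr.
have Eb : forces w (Eq b a').
  apply: (forces_IsPair_diag Hu' wr).
  by apply: forces_Mem_eqr (forces_mono wq Ev) _; apply: forces_mono bv.
have Eb' : forces w (Eq b' a).
  apply: (forces_IsPair_diag Hu wr).
  by apply: (forces_Mem_eqr Ev'); apply: forces_mono bv'.
apply: (forces_Eq_trans Eb); apply: forces_Eq_trans (forces_Eq_sym Eb').
by apply: forces_Eq_sym; apply: forces_mono aa'.
Qed.

(** * Canonical names *)

(** Membership up to Leibniz equality of trees, which is enough for the sets
    that occur here. *)
Definition vmem (x y : vset) : Prop :=
  let: VSet T f := y in exists i : T, x = f i.

Lemma forces_Mem_check p a (y : vset) :
  forces p (Mem a (check P y)) <->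
  forall q, (q <= p)%O -> exists2 r, (r <= q)%O &
    exists2 x, vmem x y & forces r (Eq a (check P x)).
Proof.
case: y => T f /=; split=> H q qp.
  have [r rq [[i c] /= rc Hi]] := H q qp.
  by exists r => //; exists (f i) => //; exists i.
have [r rq [x [i ->] Hi]] := H q qp.
by exists r => //; exists (i, r).
Qed.

Lemma forces_Mem_checkI p (x y : vset) :
  vmem x y -> forces p (Mem (check P x) (check P y)).
Proof.
move=> xy; apply/forces_Mem_check => q qp; exists q => //; exists x => //.
exact: forces_Eq_refl.
Qed.

Lemma vmem_nat (x : vset) n :
  vmem x (vnat n) <-> exists2 m, m < n & x = vnat m.
Proof.
elim: n x => [|n IH] x /=; first by split=> [[]|[]].
case E: (vnat n) => [T f]; rewrite E /= in IH.
split=> [[[i|] ->]|[m mn ->]] /=.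
- have [|m mn ->] := (IH (f i)).1; first by exists i.
  by exists m => //; apply: ltnW.
- by exists n.
move: mn; rewrite ltnS leq_eqVlt => /orP[/eqP ->|mn].
  by exists None; rewrite /= E.
have [|i ->] := (IH (vnat m)).2; first by exists m.
by exists (Some i).
Qed.

(** If m = n were forced, then m, being an element of n, would be forced to be
    an element of itself, hence to be equal to some k < m. *)
Lemma forces_Eq_nat_neq p m n : m < n ->
  ~ forces p (Eq (check P (vnat m)) (check P (vnat n))).
Proof.
elim/ltn_ind: m n p => m IH n p mn E.
have : forces p (Mem (check P (vnat m)) (check P (vnat m))).
  apply: forces_Mem_eqr (forces_Eq_sym E) _.
  by apply: forces_Mem_checkI; apply/vmem_nat; exists m.
move=> /forces_Mem_check/(_ p (lexx p))[r _ [_ /vmem_nat[k km ->]]].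
by move=> /forces_Eq_sym; apply: IH.
Qed.

Lemma forces_Eq_nat_inj p m n :
  forces p (Eq (check P (vnat m)) (check P (vnat n))) -> m = n.
Proof.
case: (ltngtP m n) => // mn E; exfalso; first exact: forces_Eq_nat_neq mn E.
exact: forces_Eq_nat_neq mn (forces_Eq_sym E).
Qed.

Lemma forces_Mem_nat p m n :
  forces p (Mem (check P (vnat m)) (check P (vnat n))) -> m < n.
Proof.
move=> /forces_Mem_check/(_ p (lexx p))[r _ [_ /vmem_nat[k km ->]]].
by move=> /forces_Eq_nat_inj ->.
Qed.

(** * Functions and cardinalities in the forcing language *)

Lemma forces_IsPair_check p (x y : vset) :
  forces p (IsPair (check P (vpair x y)) (check P x) (check P y)).
Proof.
apply/forces_IsPair; split.
- by apply: forces_Mem_checkI; exists true.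
- by apply: forces_Mem_checkI; exists false.
move=> w q qp /forces_Mem_check H; apply/forces_Or => q' /H[r rq' [_ [i ->] E]].
by exists r => //; case: i E => E; [left|right].
Qed.

Lemma forces_IsOpair_check p (x y : vset) :
  forces p (IsOpair (check P (vopair x y)) (check P x) (check P y)).
Proof.
apply: (forces_ExI (a := check P (vpair x x))).
apply: (forces_ExI (a := check P (vpair x y))).
by split; [|split]; apply: forces_IsPair_check.
Qed.

Lemma forces_Maps_vreal p f (x : nat -> nat) n b :
  forces p (Eq f (check P (vreal x))) ->
  forces p (Maps f (check P (vnat n)) b) ->
  forces p (Eq b (check P (vnat (x n)))).
Proof.
move=> Ef /forces_ExInE; apply=> q z qp zf Hz.
have {}zf := forces_Mem_eqr (forces_mono qp Ef) zf.
apply: forces_dense => q' q'q.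
have [r rq' [_ [m ->] Ez]] := (forces_Mem_check q z _).1 zf q' q'q.
exists r => //.
have /forces_And[/forces_Eq_nat_inj -> //] := forces_IsOpair_inj
  (forces_Eq_sym Ez) (@forces_IsOpair_check r _ _)
  (forces_mono (le_trans rq' q'q) Hz).
exact: forces_Eq_sym.
Qed.

Lemma forces_Maps_eq p f a b b' : forces p (Eq b b') ->
  forces p (Maps f a b) -> forces p (Maps f a b').
Proof.
move=> E /forces_ExInE; apply=> q z qp zf Hz; apply: (forces_ExI (a := z)).
by split=> //; apply: forces_IsOpair_eq Hz; apply: forces_mono E.
Qed.

(** The codomain clause of [IsFun] bounds the second coordinate b' of some
    decomposition of each z in g, and l has as its value the second coordinate b
    of another one; the injectivity of pairs identifies b and b'. *)
Lemma forces_CardLe_image p g s m n l :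
  forces p (IsFun g s (fun b => Mem b m)) ->
  forces p (Eq m (check P (vnat n))) ->
  forces p (Mem l s) ->
  exists2 q, (q <= p)%O &
    exists2 k, k < n & forces q (Maps g l (check P (vnat k))).
Proof.
move=> /forces_And[Hg1 /forces_And[Hg2 _]] Em ls.
have [q1 q1p [b lb]] := forces_Ex_witness (forces_AllIn Hg2 (lexx p) ls).
have [q2 q21 [z zg zlb]] := forces_ExIn_witness lb.
have q2p := le_trans q21 q1p.
have [q3 q32 [a _ Ha]] := forces_ExIn_witness (forces_AllIn Hg1 q2p zg).
have [q4 q43 [b' /forces_And[b'm zab']]] := forces_Ex_witness Ha.
have q42 := le_trans q43 q32; have q4p := le_trans q42 q2p.
have /forces_And[_ bb'] := forces_IsOpair_inj (forces_Eq_refl q4 z)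
  (forces_mono q42 zlb) zab'.
move: (forces_Mem_eqr (forces_mono q4p Em) b'm).
move=> /forces_Mem_check/(_ q4 (lexx _))[q5 q54 [_ /vmem_nat[k kn ->]] Ek].
exists q5; first exact: le_trans q54 q4p.
exists k => //; apply: (@forces_Maps_eq _ _ _ b).
  exact: forces_Eq_trans (forces_mono q54 bb') Ek.
apply: (forces_ExI (a := z)); split.
  exact: forces_mono (le_trans q54 q42) zg.
exact: forces_mono (le_trans q54 q42) zlb.
Qed.

(** Deciding the values of the injection one by one gives a single condition and
    a ground model function v that sends each l in L to a number below n; as the
    condition forces the injection to be injective, v is injective on L. *)
Lemma forces_CardLe p s m n (L : seq nat) :
  forces p (CardLe s m) -> forces p (Eq m (check P (vnat n))) -> uniq L ->
  (forall l, l \in L -> forces p (Mem (check P (vnat l)) s)) -> size L <= n.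
Proof.
move=> /forces_Ex_witness[q qp [g /forces_And[Hg Hinj]]] Em uL Ls.
have [r rq [v Hv]] : exists2 r, (r <= q)%O & exists v : nat -> nat,
    forall l, l \in L ->
      v l < n /\ forces r (Maps g (check P (vnat l)) (check P (vnat (v l)))).
  elim: L Ls {uL} => [_|l L IH Ls]; first by exists q => //; exists id.
  have [l' l'L|r rq [v Hv]] := IH; first by apply: Ls; rewrite in_cons l'L orbT.
  have rp := le_trans rq qp.
  have [|w wr [k kn Hk]] := forces_CardLe_image (forces_mono rq Hg)
    (forces_mono rp Em) (l := check P (vnat l)).
    by apply: forces_mono rp _; apply: Ls; apply: mem_head.
  exists w; first exact: le_trans wr rq.
  exists (fun l' => if l' == l then k else v l') => l'; rewrite in_cons.
  case: eqP => [-> //|_ /= /Hv[vn Hl']]; split=> //; exact: forces_mono wr Hl'.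
rewrite -(size_map v) -(size_iota 0 n); apply: uniq_leq_size; last first.
  by move=> _ /mapP[l /Hv[vn _] ->]; rewrite mem_iota.
rewrite map_inj_in_uniq // => l l' /Hv[_ Hl] /Hv[_ Hl'] E.
apply: (@forces_Eq_nat_inj r).
have /forces_Imp := forces_AllE (check P (vnat (v l)))
  (forces_AllE (check P (vnat l')) (forces_AllE (check P (vnat l)) Hinj)).
by apply=> //; apply/forces_And; split=> //; rewrite E.
Qed.

Lemma forces_vreals p (H : set (nat -> nat)) h' :
  forces p (Mem h' (check P (vreals H))) ->
  exists2 q, (q <= p)%O &
    exists2 h, H h & forces q (Eq h' (check P (vreal h))).
Proof.
move=> /forces_Mem_check/(_ p (lexx p))[q qp [_ [[h Hh] ->] E]].
by exists q => //; exists h.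
Qed.

Lemma forces_IsFun_inj p f A F a b b' : forces p (IsFun f A F) ->
  forces p (Maps f a b) -> forces p (Maps f a b') -> forces p (Eq b b').
Proof.
move=> /forces_And[_ /forces_And[_ H]] fb fb'.
have /forces_Imp := forces_AllE b' (forces_AllE b (forces_AllE a H)).
by apply=> //; apply/forces_And.
Qed.

End Forces.

(** * Values of a slalom *)

Definition HasValue (N : Type) (f i k : N) : formula N :=
  Ex (fun s => And (Maps f i s) (Mem k s)).

(** The second conjunct of [slaloms_formula] for a fixed h. *)
Definition BoundedBy (N : Type) (omega f h : N) : formula N :=
  AllIn omega (fun i => Ex (fun s => Ex (fun m =>
    And (Maps f i s) (And (Maps h i m) (CardLe s m))))).

Section Slalom.
Context {d : Order.disp_t} {P : preorderType d}.
Implicit Types (p q r : P) (f : name P).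

Lemma forces_HasValue_size p f F h' (h : nat -> nat) i (A : seq nat) :
  forces p (IsFun f (check P vomega) F) ->
  forces p (Eq h' (check P (vreal h))) ->
  forces p (BoundedBy (check P vomega) f h') ->
  uniq A ->
  (forall k, k \in A ->
    forces p (HasValue f (check P (vnat i)) (check P (vnat k)))) ->
  size A <= h i.
Proof.
move=> Hf Eh Hb uA HA.
have iw : forces p (Mem (check P (vnat i)) (check P vomega)).
  by apply: forces_Mem_checkI; exists i.
have [q qp [s /forces_Ex_witness[r rq [m]]]] :=
  forces_Ex_witness (forces_AllIn Hb (lexx p) iw).
move=> /forces_And[fs /forces_And[hm sm]]; have rp := le_trans rq qp.
(* The set s is the value f(i), and each k in A is an element of it because f is
   single-valued. *)
apply: (forces_CardLe sm _ uA) => [|k /HA kA].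
  exact: forces_Maps_vreal (forces_mono rp Eh) hm.
move: (forces_mono rp kA) => /forces_ExE; apply=> w s' wr /forces_And[fs' ks'].
apply: forces_Mem_eqr ks'; apply: forces_IsFun_inj fs' (forces_mono wr fs).
exact: forces_mono (le_trans wr rp) Hf.
Qed.

End Slalom.

(** * Counting in linked sets *)

Lemma card_fset_set_le (I : choiceType) (S : set I) (B : nat) :
  (forall A : {fset I}, [set` A] `<=` S -> #|` A| <= B) ->
  finite_set S /\ #|` fset_set S| <= B.
Proof.
move=> H; suff finS : finite_set S.
  by split=> //; apply: H; rewrite fset_setK.
apply: contrapT => /(infinite_set_fset B.+1)[A /H AB].
by rewrite ltnNge AB.
Qed.

Lemma card_fset_fibers (I J : choiceType) (g : I -> J) (c : nat)
    (A : {fset I}) (B : {fset J}) :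
  (forall y, #|` [fset x in A | g x == y]%fset| <= c) ->
  #|` [fset x in A | g x \in B]%fset| <= #|` B| * c.
Proof.
move=> Hc; elim/fset1U_rect: B => [|y B yB IH].
  rewrite cardfs0 mul0n leqn0 cardfs_eq0.
  by apply/eqP/fsetP => x; rewrite !inE andbF.
rewrite cardfsU1 yB mulnDl mul1n.
have -> : [fset x in A | g x \in (y |` B)]%fset =
    ([fset x in A | g x == y] `|` [fset x in A | g x \in B])%fset.
  by apply/fsetP => x; rewrite !inE andb_orr.
by rewrite (leq_trans (leq_card_fsetU _ _)) // leq_add.
Qed.

(** This is where linkedness is used.  If the union is large, then, as no
    condition accounts for more than c of its elements, many distinct
    conditions are needed to account for all of them; the linkedness of D
    provides more than c of these conditions with a common extension, which
    inherits a different element from each of them and so violates its own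
    bound c. *)
Lemma linked_union_card (d : Order.disp_t) (P : preorderType d) (I : choiceType)
    (W : P -> set I) (D : set P) (c K : nat) :
  (forall p q, (q <= p)%O -> W p `<=` W q) ->
  (forall p q (A : {fset I}), D p -> (q <= p)%O -> [set` A] `<=` W q ->
    #|` A| <= c) ->
  (forall B : {fset P}, [set` B] `<=` D -> #|` B| = K ->
    exists Q : {fset P},
      [/\ (Q `<=` B)%fset, c < #|` Q| & exists r, common_extension Q r]) ->
  forall A : {fset I}, [set` A] `<=` \bigcup_(p in D) W p ->
    #|` A| <= K * c.
Proof.
move=> Wmono Wc link A AW.
have [->|[k0 k0A]] := fset_0Vmem A; first by rewrite cardfs0.
have [p0 Dp0 _] := AW _ k0A.
have [g gP] : exists g : I -> P, forall k, k \in A -> D (g k) /\ W (g k) k.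
  have /choice[g gP] : forall k, exists p, k \in A -> D p /\ W p k.
    move=> k; have [kA|] := boolP (k \in A); last by exists p0.
    by have [p Dp Wp] := AW _ kA; exists p.
  by exists g.
have fib (y : P) : #|` [fset k in A | g k == y]%fset| <= c.
  have [->|[k]] := fset_0Vmem [fset k in A | g k == y]%fset.
    by rewrite cardfs0.
  rewrite !inE => /andP[/gP[Dk _] /eqP gk].
  apply: (Wc (g k) (g k)) => // l /=; rewrite !inE => /andP[/gP[_ Wl] /eqP gl].
  by rewrite gk -gl.
have AE : A = [fset k in A | g k \in (g @` A)%fset]%fset.
  apply/fsetP => k; rewrite !inE; have [kA|//] := boolP (k \in A).
  by rewrite in_imfset.
rewrite {}[in X in X <= _]AE (leq_trans (card_fset_fibers _ fib)) // leq_mul2r.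
apply/orP; right; rewrite leqNgt; apply/negP => ltK.
pose B := [fset p in take K (g @` A)%fset]%fset.
have BA p : p \in B -> exists2 k, k \in A & p = g k.
  by rewrite !inE => /mem_take/imfsetP[k kA ->]; exists k.
have [||Q [QB cQ [r rQ]]] := link B.
- by move=> p /= /BA[k /gP[Dk _] ->].
- rewrite card_fseq undup_id ?take_uniq ?fset_uniq // size_take.
  by rewrite ltK.
have QA : (Q `<=` g @` [fset k in A | g k \in Q])%fset.
  apply/fsubsetP => p pQ; have [k kA E] := BA _ (fsubsetP QB _ pQ).
  by apply/imfsetP; exists k => //=; rewrite !inE kA -E.
have [Q0|[p pQ]] := fset_0Vmem Q; first by rewrite Q0 cardfs0 in cQ.
have [k kA pk] := BA _ (fsubsetP QB _ pQ).
have : #|` [fset k in A | g k \in Q]%fset| <= c.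
  apply: (Wc p r); [by rewrite pk; case: (gP k kA)|exact: rQ|].
  move=> l /=; rewrite !inE => /andP[/gP[_ Wl] /rQ rl].
  exact: Wmono rl _ Wl.
rewrite leqNgt => /negP; apply; apply: leq_trans cQ _.
apply: leq_trans (fsubset_leq_card QA) _.
by apply: leq_trans (leq_imfset_card _ _ _) _.
Qed.

(** * Goodness *)

(** Applying to h the operations g |-> (i |-> K n (g i) * g i) for the n in s,
    starting with the last entry of s. *)
Definition grow (K : nat -> nat -> nat) (h : nat -> nat) (s : seq nat)
  (i : nat) : nat := foldr (fun n c => K n c * c) (h i) s.

Theorem theoremA (rho : nat -> nat -> nat) (h : nat -> nat)
  (hrho : admissible rho) (hh : h @ \oo --> \oo) :
  exists h_ : nat -> nat -> nat,
    h_ 0 = h /\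
    forall (d : Order.disp_t) (P : preorderType d),
      sigma_linked P rho -> good (LcStar (range h_)) P.
Proof.
have [K rhoK] : exists K : nat -> nat -> nat, forall n c, c < rho n (K n c).
  have ex n c : exists k, c < rho n k.
    have : (rho n @ \oo) [set k | c < k].
      by apply: (admissible_cvg hrho n); exists c.+1.
    by move=> [N _ /(_ N (leqnn N))]; exists N.
  have /choice[K HK] : forall nc : nat * nat, exists k, nc.2 < rho nc.1 k.
    by move=> [n c]; apply: ex.
  by exists (fun n c => K (n, c)) => n c; apply: (HK (n, c)).
(* The code 0 is that of the empty list, whence h_ 0 = h. *)
exists (fun l => grow K h (CodeSeq.decode l)); split => //.
set h_ := fun l => _.
have h_step n m : exists l, forall i, h_ l i = K n (h_ m i) * h_ m i.
  exists (CodeSeq.code (n :: CodeSeq.decode m)) => i.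
  by rewrite /h_ CodeSeq.codeK.
move=> d P [P_ [densP linkP]] f Hf.
have Hfun p : forces p (IsFun f (check P vomega) (IsFinset (check P vomega))).
  by have /forces_And[] := Hf p.
pose D n m : set P := [set p | P_ n p /\ exists2 h',
  forces p (Eq h' (check P (vreal (h_ m)))) &
  forces p (BoundedBy (check P vomega) f h')].
pose W i p : set nat :=
  [set k | forces p (HasValue f (check P (vnat i)) (check P (vnat k)))].
pose phi (nm : nat * nat) i := fset_set (\bigcup_(p in D nm.1 nm.2) W i p).
have phiP n m i : finite_set (\bigcup_(p in D n m) W i p) /\
    #|` phi (n, m) i| <= K n (h_ m i) * h_ m i.
  apply/card_fset_set_le/linked_union_card.
  - by move=> p q qp k; apply: forces_mono.
  - move=> p q A [_ [h' Eh Hb]] qp AW.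
    apply: (forces_HasValue_size (Hfun q) (forces_mono qp Eh)
      (forces_mono qp Hb)) => //.
    exact: fset_uniq.
  - move=> B BD BK; have [|Q [QB Qc Qr]] := linkP n B; first by move=> p /BD[].
    by exists Q; split=> //; rewrite Qc BK.
exists (range phi); split.
- move=> _ [[n m] _ <-]; have [l hl] := h_step n m.
  by exists (h_ l); [exists l|move=> i; rewrite hl; case: (phiP n m i)].
- by exists (phi (0, 0)); exists (0, 0).
- apply: sub_countable (card_image_le _ _) _; exact: countableP.
move=> x _ xphi p q qp.
(* From a condition q that forces x in f almost everywhere, pass to one that
   decides the threshold M and the bound h_ m and that belongs to some P_ n. *)
rewrite -/(forces q (eventually_in_formula (check P) (check P (vreal x)) f)).
move=> xf.
have [q1 q1q [m' /forces_Mem_check/(_ q1 (lexx _))[q2 q21 [_ [M ->] EM]] xm]] :=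
  forces_ExIn_witness xf.
have /forces_And[_ Hb] := Hf q2.
have [q3 q32 [h' /forces_vreals[q4 q43 [_ [m _ <-] Eh]] {}Hb]] :=
  forces_ExIn_witness Hb.
have [r [n _ Pr] rq4] := densP q4.
have r2 := le_trans rq4 (le_trans q43 q32).
have Dr : D n m r.
  split=> //; exists h'; first exact: forces_mono rq4 Eh.
  exact: forces_mono (le_trans rq4 q43) Hb.
apply: (xphi (phi (n, m))); first by exists (n, m).
exists M => // i /= Mi; rewrite in_fset_set; last by case: (phiP n m i).
apply/mem_set; exists r => //.
have iw : forces r (Mem (check P (vnat i)) (check P vomega)).
  by apply: forces_Mem_checkI; exists i.
move: (forces_AllIn xm (le_trans r2 q21) iw) => /forces_OrE; apply=> w wr.
  move=> /(forces_Mem_eqr (forces_mono (le_trans wr r2) EM))/forces_Mem_nat.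
  by rewrite ltnNge Mi.
move=> /forces_ExE; apply=> w1 k w1w /forces_ExE; apply=> w2 s w21.
move=> /forces_And[xk /forces_And[fs ks]].
apply: (forces_ExI (a := s)); apply/forces_And; split=> //.
apply: forces_Mem_eql ks; apply: forces_Maps_vreal xk; exact: forces_Eq_refl.
Qed.
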